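(* Let $q=2^r$, let $\mathcal{K}$ be a translation $k$-arc in $PG(2,q)$ with $k\ge 4$, and let $\varphi$ be a homology of $PG(2,q)$ with axis $\ell_\infty$ and centre not in $\mathcal{K}$. If the set $\mathcal{K}'=\mathcal{K}\cup\varphi(\mathcal{K})$ is an arc, then there exists a non-linear blocking set $\mathcal{B}$ of the secants of $\mathcal{K}'$ of minimum size.
   Context: $PG(2,q)$ is the Desarguesian projective plane over $\mathbb{F}_q$, with homogeneous coordinates $(X_1,X_2,X_3)$, and $\ell_\infty$ is the line $X_3=0$. A homology with axis $\ell_\infty$ is a non-identity projectivity (linear collineation) fixing every point of $\ell_\infty$ and every line through some point (its centre) not on $\ell_\infty$. A $k$-arc is a set of $k$ points no three of which are collinear. A secant of an arc is a line containing two (distinct) points of it. A blocking set of the secants of an $m$-arc $\mathcal{A}$ is a point set $\mathcal{B}\subset PG(2,q)\setminus\mathcal{A}$ having non-empty intersection with each secant of $\mathcal{A}$; such a set always has at least $m-1$ points, and it is said to be of minimum size if it has exactly $m-1$ points. It is linear if it is contained in a line, and non-linear otherwise. For $A=(a_1,a_2)\in\mathbb{F}_q\times\mathbb{F}_q$ let $\varphi_A:(X_1,X_2,X_3)\mapsto(X_1+a_1X_3,\,X_2+a_2X_3,\,X_3)$. For an additive subgroup $G$ of $\mathbb{F}_q\times\mathbb{F}_q$ and a point $P\in PG(2,q)\setminus\ell_\infty$, let $\mathcal{K}_G(P)=\{\varphi_A(P)\mid A\in G\}$. A translation $k$-arc is a $k$-arc in $PG(2,q)$ coinciding with $\mathcal{K}_G(P)$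 for some additive subgroup $G$ of $\mathbb{F}_q\times\mathbb{F}_q$ and some $P\in PG(2,q)\setminus \ell_\infty$. *)

(* Defs.v *)
From HB Require Import structures.
From mathcomp Require Import all_boot all_order all_algebra.
Set Implicit Arguments.
Unset Strict Implicit.
Unset Printing Implicit Defensive.

Import GRing.Theory.
Local Open Scope ring_scope.

(* PG(2,q) is the lattice of subspaces of F^3.  Indices start at 0, so the
   homogeneous coordinates X_1, X_2, X_3 of v : 'rV[F]_3 are v 0 0, v 0 1 and
   v 0 2. *)

HB.instance Definition _ (F : finFieldType) (vT : vectType F) :=
  Countable.copy {vspace vT} (can_type (@VectorInternalTheory.vs2mxK F vT)).
HB.instance Definition _ (F : finFieldType) (vT : vectType F) :
  isFinite {vspace vT} := CanIsFinite (@VectorInternalTheory.vs2mxK F vT).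

Definition point (F : finFieldType) : Type :=
  {U : {vspace 'rV[F]_3} | \dim U == 1%N}.
HB.instance Definition _ (F : finFieldType) := Finite.on (point F).

Definition line (F : finFieldType) : Type :=
  {U : {vspace 'rV[F]_3} | \dim U == 2}.
HB.instance Definition _ (F : finFieldType) := Finite.on (line F).

Definition incident (F : finFieldType) (P : point F) (l : line F) : bool :=
  (val P <= val l)%VS.

Definition points_on (F : finFieldType) (l : line F) : {set point F} :=
  [set P | incident P l].

Lemma act_point_subproof (F : finFieldType) (f : 'End('rV[F]_3))
    (f_inj : lker f == 0%VS) (P : point F) : \dim (f @: val P) == 1%N.
Proof.
by rewrite limg_dim_eq ?(eqP (valP P)) // (eqP f_inj) capv0.
Qed.

(* The argument f_inj makes f a nonsingular linear map, as 'rV[F]_3 has finite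
   dimension. *)
Definition act_point (F : finFieldType) (f : 'End('rV[F]_3))
    (f_inj : lker f == 0%VS) (P : point F) : point F :=
  Sub (f @: val P)%VS (act_point_subproof f_inj P).

Definition projectivity (F : finFieldType) (phi : point F -> point F) : Prop :=
  exists (f : 'End('rV[F]_3)) (f_inj : lker f == 0%VS),
    phi =1 act_point f_inj.

Definition homology (F : finFieldType) (phi : point F -> point F)
    (axis : line F) (C : point F) : Prop :=
  [/\ projectivity phi,
      ~ phi =1 id,
      forall P, incident P axis -> phi P = P,
      ~~ incident C axis &
      forall l, incident C l -> phi @: points_on l = points_on l].

Definition X3 (F : finFieldType) (v : 'rV[F]_3) : F^o := v 0 2.

Lemma X3_is_linear (F : finFieldType) : linear (@X3 F).
Proof. by move=> a u v; rewrite /X3 !mxE. Qed.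
HB.instance Definition _ (F : finFieldType) :=
  GRing.isLinear.Build F 'rV[F]_3 F^o *:%R (@X3 F) (@X3_is_linear F).

Lemma linfty_subproof (F : finFieldType) : \dim (lker (linfun (@X3 F))) == 2.
Proof.
have := limg_ker_dim (linfun (@X3 F)) fullv.
rewrite capfv dimvf /dim /=.
suff -> : limg (linfun (@X3 F)) = fullv.
  by rewrite dimvf /dim /= => /eqP; rewrite (eqn_add2r 1 _ 2).
apply/vspaceP => a; rewrite memvf.
have <- : linfun (@X3 F) (a *: delta_mx 0 2) = a.
  by rewrite lfunE /= /X3 !mxE !eqxx mulr1.
exact/memv_img/memvf.
Qed.

Definition linfty (F : finFieldType) : line F :=
  Sub (lker (linfun (@X3 F))) (linfty_subproof F).

Lemma incident_linfty (F : finFieldType) (P : point F) :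
  reflect (forall v, v \in val P -> v 0 2 = 0) (incident P (linfty F)).
Proof.
apply: (iffP subvP) => sP v vP; last by rewrite memv_ker lfunE; apply/eqP/sP.
by move: (sP v vP); rewrite memv_ker lfunE => /eqP.
Qed.

Definition translate (F : finFieldType) (A : F * F) (v : 'rV[F]_3) : 'rV[F]_3 :=
  \row_j [:: v 0 0 + A.1 * v 0 2; v 0 1 + A.2 * v 0 2; v 0 2]`_j.

Lemma translate_is_linear (F : finFieldType) (A : F * F) : linear (translate A).
Proof.
move=> a u v; apply/rowP => j; rewrite !mxE.
by case: j => [[|[|[|//]]] ?] /=; rewrite ?mulrDr ?mulrDl 1?mulrCA 1?addrACA.
Qed.
HB.instance Definition _ (F : finFieldType) (A : F * F) :=
  GRing.isLinear.Build F 'rV[F]_3 'rV[F]_3 *:%R (translate A)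
    (translate_is_linear A).

Lemma translate_inj (F : finFieldType) (A : F * F) :
  lker (linfun (translate A)) == 0%VS.
Proof.
apply/lker0P => u v; rewrite !lfunE /= => /rowP e.
have e2 : u 0 2 = v 0 2 by have := e 2; rewrite !mxE.
apply/rowP; case=> [[|[|[|//]]] lt_j3].
- by move: (e 0); rewrite !mxE /= e2 => /addIr; congr (u _ _ = v _ _);
    apply: val_inj.
- by move: (e 1); rewrite !mxE /= e2 => /addIr; congr (u _ _ = v _ _);
    apply: val_inj.
- by move: e2; congr (u _ _ = v _ _); apply: val_inj.
Qed.

Definition translation (F : finFieldType) (A : F * F) : point F -> point F :=
  act_point (translate_inj A).

Definition is_arc (F : finFieldType) (K : {set point F}) : Prop :=
  forall P Q R : point F, P \in K -> Q \in K -> R \in K ->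
    P != Q -> P != R -> Q != R ->
    ~ exists l : line F, [/\ incident P l, incident Q l & incident R l].

Definition k_arc (F : finFieldType) (k : nat) (K : {set point F}) : Prop :=
  #|K| = k /\ is_arc K.

Definition translation_orbit (F : finFieldType) (G : {set F * F}) (P : point F) :
    {set point F} :=
  [set translation A P | A in G].

Definition translation_arc (F : finFieldType) (k : nat) (K : {set point F}) :
    Prop :=
  k_arc k K /\
  exists (G : {set F * F}) (P : point F),
    [/\ zmod_closed G, ~~ incident P (linfty F) & K = translation_orbit G P].

Definition secant (F : finFieldType) (K : {set point F}) (l : line F) : Prop :=
  exists P Q : point F,
    [/\ P \in K, Q \in K, P != Q, incident P l & incident Q l].

Definition blocking_set (F : finFieldType) (B K : {set point F}) : Prop :=
  [disjoint B & K] /\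
  forall l : line F, secant K l -> exists2 P, P \in B & incident P l.

Definition minimum_blocking_set (F : finFieldType) (B K : {set point F}) :
    Prop :=
  blocking_set B K /\ #|B| = (#|K| - 1)%N.

Definition linear_set (F : finFieldType) (B : {set point F}) : Prop :=
  exists l : line F, B \subset points_on l.

(* Main.v *)
(* Take the centre C as affine origin: the homology is v |-> lam v on the affine
   plane, K = s + H with H an additive group, and phi(K) = lam (s + H).  The
   secants of K and those of phi(K) meet the line at infinity exactly in the
   |H| - 1 directions of the nonzero elements of H.  In characteristic 2 the
   line through s + a and lam (s + b) contains
     (lam (s + a) + lam (s + b)) / (1 + lam) = (lam / (1 + lam)) (a + b),
   so the |H| affine points (lam / (1 + lam)) H block the mixed secants.  These
   2|H| - 1 points are not collinear, as at least two of them are at infinity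
   and C is among the others. *)
Require Import Defs.
From mathcomp Require Import all_boot all_order all_algebra all_field.
Set Implicit Arguments.
Unset Strict Implicit.
Unset Printing Implicit Defensive.

Import GRing.Theory.
Local Open Scope ring_scope.

(** * Points as spans of vectors, and the line joining two points *)

Lemma row_neq0 (F : finFieldType) (n : nat) (v : 'rV[F]_n) (i : 'I_n) :
  v 0 i != 0 -> v != 0.
Proof. by apply: contraNneq => ->; rewrite mxE. Qed.

Lemma span_point_default_subproof (F : finFieldType) :
  \dim <[const_mx 1%R : 'rV[F]_3]>%VS == 1%N.
Proof.
by rewrite dim_vline (row_neq0 (i := 0)) // mxE oner_neq0.
Qed.

(* At [v = 0] the value is the junk point spanned by (1, 1, 1). *)
Definition span_point (F : finFieldType) (v : 'rV[F]_3) : point F :=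
  insubd (Sub <[const_mx 1%R]>%VS (span_point_default_subproof F) : point F)
    <[v]>%VS.

Lemma val_span_point (F : finFieldType) (v : 'rV[F]_3) :
  v != 0 -> val (span_point v) = <[v]>%VS.
Proof. by move=> nz_v; rewrite insubdK // unfold_in dim_vline nz_v. Qed.

Lemma span_pointP (F : finFieldType) (P : point F) :
  exists2 v, v != 0 & P = span_point v.
Proof.
have nzP : vpick (val P) != 0.
  by rewrite vpick0 -dimv_eq0 (eqP (valP P)).
exists (vpick (val P)) => //; apply: val_inj; rewrite val_span_point //.
apply/esym/eqP; rewrite eqEdim -memvE memv_pick dim_vline nzP.
by rewrite (eqP (valP P)).
Qed.

Lemma mem_span_point (F : finFieldType) (v u : 'rV[F]_3) : v != 0 -> u != 0 ->
  u \in val (span_point v) -> span_point u = span_point v.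
Proof.
move=> nzv nzu; rewrite val_span_point // => uv; apply: val_inj.
rewrite !val_span_point //; apply/eqP.
by rewrite eqEdim -memvE uv !dim_vline nzv nzu.
Qed.

Lemma span_pointZ (F : finFieldType) (v : 'rV[F]_3) (a : F) :
  a != 0 -> v != 0 -> span_point (a *: v) = span_point v.
Proof.
move=> nza nzv; apply: mem_span_point => //; first by rewrite scaler_eq0 negb_or nza.
by rewrite val_span_point // memvZ ?memv_line.
Qed.

Lemma incident_span_point (F : finFieldType) (v : 'rV[F]_3) (l : line F) :
  v != 0 -> incident (span_point v) l = (v \in val l).
Proof. by move=> nzv; rewrite /incident val_span_point // memvE. Qed.

Lemma dim_join (F : finFieldType) (P Q : point F) :
  P != Q -> \dim (val P + val Q)%VS = 2.
Proof.
move=> neqPQ; have := dimv_sum_cap (val P) (val Q).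
rewrite (eqP (valP P)) (eqP (valP Q)).
suff -> : \dim (val P :&: val Q) = 0 by rewrite addn0.
apply: contraNeq neqPQ => nz0.
have lt0 : (1 <= \dim (val P :&: val Q))%N by rewrite lt0n.
apply/eqP/val_inj; transitivity (val P :&: val Q)%VS; last apply/eqP.
  by apply/eqP; rewrite eq_sym eqEdim capvSl (eqP (valP P)).
by rewrite eqEdim capvSr (eqP (valP Q)).
Qed.

Lemma join_lineP (F : finFieldType) (P Q : point F) :
  P != Q -> exists l : line F, val l = (val P + val Q)%VS.
Proof. by move/dim_join/eqP => dPQ; exists (Sub (val P + val Q)%VS dPQ). Qed.

Lemma line_eq_join (F : finFieldType) (P Q : point F) (l : line F) :
  P != Q -> incident P l -> incident Q l -> val l = (val P + val Q)%VS.
Proof.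
rewrite /incident => neqPQ Pl Ql; apply/esym/eqP.
by rewrite eqEdim subv_add Pl Ql (eqP (valP l)) dim_join.
Qed.

(** * Affine points, represented by vectors with last coordinate 1 *)

Lemma normal_affine (F : finFieldType) (P : point F) :
  ~~ incident P (linfty F) -> exists2 v : 'rV[F]_3, v 0 2 = 1 & P = span_point v.
Proof.
have [v nzv ->] := span_pointP P; rewrite incident_span_point // memv_ker lfunE /=.
rewrite /X3 => nz3; exists ((v 0 2)^-1 *: v); first by rewrite mxE mulVf.
by rewrite span_pointZ ?invr_eq0.
Qed.

Lemma affine_neq0 (F : finFieldType) (v : 'rV[F]_3) : v 0 2 = 1 -> v != 0.
Proof. by move=> v1; apply: (row_neq0 (i := 2)); rewrite v1 oner_neq0. Qed.

Lemma span_point_affine_inj (F : finFieldType) (u v : 'rV[F]_3) :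
  u 0 2 = 1 -> v 0 2 = 1 -> span_point u = span_point v -> u = v.
Proof.
move=> u1 v1 /(congr1 val); rewrite !val_span_point ?affine_neq0 // => e.
have : u \in <[v]>%VS by rewrite -e memv_line.
case/vlineP => a eu; move: u1; rewrite eu mxE v1 mulr1 => ->.
by rewrite scale1r.
Qed.

Lemma act_span_point (F : finFieldType) (f : 'End('rV[F]_3))
    (f_inj : lker f == 0%VS) (v : 'rV[F]_3) :
  v != 0 -> f v != 0 /\ act_point f_inj (span_point v) = span_point (f v).
Proof.
move=> nzv; have nzf : f v != 0.
  by apply: contra nzv; rewrite -memv_ker (eqP f_inj) memv0.
by split=> //; apply: val_inj; rewrite /= !val_span_point // limg_line.
Qed.

(** * Coordinate form of a homology with axis [linfty] *)

Lemma row3_eqP (F : finFieldType) (u v : 'rV[F]_3) :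
  u 0 0 = v 0 0 -> u 0 1 = v 0 1 -> u 0 2 = v 0 2 -> u = v.
Proof.
move=> e0 e1 e2; apply/rowP; case=> [[|[|[|//]]] lt_j3].
- by move: e0; congr (u _ _ = v _ _); apply: val_inj.
- by move: e1; congr (u _ _ = v _ _); apply: val_inj.
- by move: e2; congr (u _ _ = v _ _); apply: val_inj.
Qed.

(** A linear lift [f] of the homology has every nonzero vector at infinity as an eigenvector, hence
    is a scalar on that plane. It also has [c] as an eigenvector, because the lines through the
    centre are invariant. The ratio of the two eigenvalues is [lam]. *)
Lemma homologyP (F : finFieldType) (phi : point F -> point F) (C : point F) :
  homology phi (linfty F) C ->
  exists (c : 'rV[F]_3) (lam : F),
    [/\ c 0 2 = 1, C = span_point c, lam != 0, lam != 1 &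
      forall w : 'rV[F]_3, w 0 2 = 0 ->
        phi (span_point (c + w)) = span_point (c + lam *: w)].
Proof.
case=> -[f [f_inj phiE]] phi_n1 phi_axis /normal_affine [c c1 ->] phi_lines.
have nzc := affine_neq0 c1.
pose e0 : 'rV[F]_3 := delta_mx 0 0; pose e1 : 'rV[F]_3 := delta_mx 0 1.
have fix_axis (w : 'rV[F]_3) : w 0 2 = 0 -> exists a, f w = a *: w.
  move=> w0; have [->|nzw] := eqVneq w 0; first by exists 0; rewrite linear0 scaler0.
  have [nzf fw] := act_span_point f_inj nzw.
  have := phi_axis (span_point w).
  rewrite incident_span_point // memv_ker lfunE /= /X3 w0 eqxx => /(_ isT).
  rewrite phiE fw => /(congr1 val); rewrite !val_span_point // => e.
  by apply/vlineP; rewrite -e memv_line.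
have [|a fe0] := fix_axis e0; first by rewrite !mxE.
have [|b fe1] := fix_axis e1; first by rewrite !mxE.
(* So far the eigenvalue may depend on the vector. Comparing [e0], [e1] and [e0 + e1] shows that it
   does not. *)
have [|d fe] := fix_axis (e0 + e1); first by rewrite !mxE addr0.
have ea : a = d.
  move: fe; rewrite linearD /= fe0 fe1 => /rowP-/(_ 0).
  by rewrite !mxE /= !mulr1 !mulr0 !addr0 mulr1.
have eb : b = d.
  move: fe; rewrite linearD /= fe0 fe1 => /rowP-/(_ 1).
  by rewrite !mxE /= !mulr1 !mulr0 !add0r mulr1.
subst a b.
have fW (w : 'rV[F]_3) : w 0 2 = 0 -> f w = d *: w.
  move=> w0; have -> : w = w 0 0 *: e0 + w 0 1 *: e1.
    by apply: row3_eqP; rewrite !mxE /= ?mulr1 ?mulr0 ?addr0 ?add0r.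
  by rewrite linearD !linearZ /= fe0 fe1 scalerDr !scalerA ![d * _]mulrC.
have [nzfc fcE] := act_span_point f_inj nzc.
have fc_line (e : 'rV[F]_3) : e != 0 -> e 0 2 = 0 ->
    exists x y, f c = x *: c + y *: e.
  move=> nze e02; have neq : span_point c != span_point e.
    apply/eqP => /(congr1 val); rewrite !val_span_point // => ece.
    have /vlineP [x ex] : c \in <[e]>%VS by rewrite -ece memv_line.
    by move/eqP: c1; rewrite ex mxE e02 mulr0 eq_sym oner_eq0.
  have [l lE] := join_lineP neq.
  have cl : incident (span_point c) l by rewrite /incident lE addvSl.
  have : phi (span_point c) \in phi @: points_on l.
    by apply: imset_f; rewrite inE.
  rewrite phi_lines // inE phiE fcE incident_span_point // lE !val_span_point //.
  by case/memv_addP => _ /vlineP [x ->] [_ /vlineP [y ->] ->]; exists x, y.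
have nze0 : e0 != 0 by apply: (row_neq0 (i := 0)); rewrite mxE oner_neq0.
have nze1 : e1 != 0 by apply: (row_neq0 (i := 1)); rewrite mxE oner_neq0.
(* The two invariant lines from the centre in the directions [e0] and [e1] meet only in the centre,
   so [f c] is a multiple of [c]. *)
have [|x [y fx]] := fc_line _ nze0; first by rewrite !mxE.
have [|x' [y' fx']] := fc_line _ nze1; first by rewrite !mxE.
have e := etrans (esym fx) fx'.
have exx : x = x'.
  by move: e => /rowP-/(_ 2); rewrite !mxE /= c1 !mulr0 !addr0 !mulr1.
subst x'; have y0 : y = 0.
  move: e => /rowP-/(_ 0); rewrite !mxE /= mulr0 mulr1 addr0.
  by move/(canRL (addKr _)) ->; rewrite addNr.
have fc : f c = x *: c by rewrite fx y0 scale0r addr0.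
have nzx : x != 0 by apply: contraNneq nzfc => x0; rewrite fc x0 scale0r.
have nzd : d != 0.
  have [+ _] := act_span_point f_inj nze0.
  by apply: contraNneq => d0; rewrite fe0 d0 scale0r.
(* [f] sends [c + w] to [x *: c + d *: w]; dividing by [x] restores the last coordinate 1. *)
exists c, (d / x); split=> //.
- by rewrite mulf_neq0 ?invr_eq0.
(* Ratio 1 would make [f] the scalar [x], as the plane at infinity and [c] span the space, and [phi]
   would be the identity. *)
- apply/eqP => dx1; apply: phi_n1 => P; have [v nzv ->] := span_pointP P.
  have {dx1} dx : d = x by rewrite -[LHS](divfK nzx) dx1 mul1r.
  rewrite phiE (act_span_point f_inj nzv).2.
  have -> : f v = x *: v; last by rewrite span_pointZ.
  have [w [t [w0 ->]]] : exists (w : 'rV[F]_3) t, w 0 2 = 0 /\ v = w + t *: c.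
    by exists (v - v 0 2 *: c), (v 0 2); rewrite subrK !mxE c1 mulr1 subrr.
  by rewrite linearD linearZ /= fc (fW _ w0) dx scalerDr !scalerA [t * x]mulrC.
- move=> w w0; have cw1 : (c + w) 0 2 = 1 by rewrite mxE c1 w0 addr0.
  rewrite phiE (act_span_point f_inj (affine_neq0 cw1)).2.
  rewrite linearD /= fc fW //.
  have -> : x *: c + d *: w = x *: (c + (d / x) *: w).
    by rewrite scalerDr scalerA mulrC divfK.
  by rewrite span_pointZ // affine_neq0 // !mxE c1 w0 mulr0 addr0.
Qed.

(** * Translation orbits in vector form *)

Definition direction (F : finFieldType) (A : F * F) : 'rV[F]_3 :=
  \row_j [:: A.1; A.2; 0]`_j.

Lemma translation_span_point (F : finFieldType) (A : F * F) (v : 'rV[F]_3) :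
  v 0 2 = 1 -> translation A (span_point v) = span_point (v + direction A).
Proof.
move=> v1; rewrite /translation.
rewrite (act_span_point (translate_inj A) (affine_neq0 v1)).2.
by congr span_point; apply: row3_eqP; rewrite lfunE !mxE /= v1 ?mulr1 ?addr0.
Qed.

(** Moving the group from pairs to vectors at infinity lets the arc, its image and its secant
    directions be written as sums and multiples of vectors. *)
Lemma translation_orbitP (F : finFieldType) (G : {set F * F}) (v : 'rV[F]_3) :
  zmod_closed G -> v 0 2 = 1 ->
  exists H : {set 'rV[F]_3},
    [/\ zmod_closed H, {in H, forall a : 'rV[F]_3, a 0 2 = 0} &
      translation_orbit G (span_point v) = [set span_point (v + a) | a in H]].
Proof.
move=> [G0 GB] v1; exists [set direction A | A in G]; split.
- split; first by apply/imsetP; exists 0 => //; apply: row3_eqP; rewrite !mxE.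
  move=> _ _ /imsetP [A GA ->] /imsetP [A' GA' ->].
  apply/imsetP; exists (A - A'); first exact: GB.
  by apply: row3_eqP; rewrite !mxE /= ?subr0.
- by move=> _ /imsetP [A _ ->]; rewrite mxE.
- rewrite /translation_orbit -imset_comp; apply: eq_imset => A /=.
  exact: translation_span_point.
Qed.

(** * Construction of the blocking set *)

(* The point set in affine form: with [c] the centre of the homology, the arc
   is [c + s + H] and its image is [c + lam (s + H)]. *)
Lemma affine_blocking_set (F : finFieldType) (c s : 'rV[F]_3) (lam : F)
    (H : {set 'rV[F]_3}) (K L : {set point F}) :
  2 \in [pchar F] -> c 0 2 = 1 -> s 0 2 = 0 -> lam != 0 -> lam != 1 ->
  zmod_closed H -> {in H, forall a : 'rV[F]_3, a 0 2 = 0} ->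
  K = [set span_point (c + (s + a)) | a in H] ->
  L = [set span_point (c + lam *: (s + a)) | a in H] ->
  span_point c \notin K -> (3 <= #|H|)%N -> is_arc (K :|: L) ->
  exists B : {set point F}, minimum_blocking_set B (K :|: L) /\ ~ linear_set B.
Proof.
move=> ch2 c1 s0 lam0 lam1 [H0 HB] H_inf KE LE CK cardH arcKL.
have mu0 : 1 + lam != 0 by rewrite addrC addr_eq0 oppr_pchar2.
pose mu := lam / (1 + lam).
have mu_neq0 : mu != 0 by rewrite mulf_neq0 ?invr_eq0.
pose aff w := span_point (c + w).
have aff1 (w : 'rV[F]_3) : w 0 2 = 0 -> (c + w) 0 2 = 1.
  by move=> w0; rewrite mxE c1 w0 addr0.
have affnz (w : 'rV[F]_3) : w 0 2 = 0 -> c + w != 0 by move/aff1/affine_neq0.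
have aff_inj (u v : 'rV[F]_3) : u 0 2 = 0 -> v 0 2 = 0 -> aff u = aff v -> u = v.
  by move=> u0 v0 /span_point_affine_inj e; apply: (addrI c); apply: e; exact: aff1.
have sH a : a \in H -> (s + a) 0 2 = 0 by move=> /H_inf a0; rewrite mxE s0 a0 addr0.
have zH b (a : 'rV[F]_3) : a 0 2 = 0 -> (b *: a) 0 2 = 0.
  by move=> a0; rewrite mxE a0 mulr0.
have KP a : a \in H -> aff (s + a) \in K :|: L.
  by move=> Ha; rewrite inE KE; apply/orP; left; apply/imsetP; exists a.
have LP a : a \in H -> aff (lam *: (s + a)) \in K :|: L.
  by move=> Ha; rewrite inE LE; apply/orP; right; apply/imsetP; exists a.
have HD a b : a \in H -> b \in H -> a + b \in H.
  move=> Ha Hb; have := HB a b Ha Hb; congr (_ \in H); congr (_ + _).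
  by rewrite -scaleN1r oppr_pchar2 // scale1r.
have add_self (v : 'rV[F]_3) : v + v = 0.
  by rewrite -mulr2n -scaler_nat (pcharf0 ch2) scale0r.
(* Here the centre lying off [K] enters: [s + a = 0] would make [c] span a point of [K]. *)
have sn0 a : a \in H -> s + a != 0.
  move=> Ha; apply: contraNneq CK => e; rewrite KE; apply/imsetP.
  by exists a; rewrite // e addr0.
(* A common point would give three collinear points y, phi y, phi (phi y). *)
have KL_disj a b : a \in H -> b \in H -> s + a <> lam *: (s + b).
  move=> Ha Hb e.
  (* In characteristic 2 the only square root of 1 is 1. Hence 1, [lam] and [lam * lam] are
     distinct, and so are the three points. *)
  have lam2 : lam * lam != 1.
    by rewrite -expr2 sqrf_eq1 oppr_pchar2 // orbb.
  have scal_neq x y : x != y -> aff (x *: (s + b)) != aff (y *: (s + b)).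
    move=> nxy; apply/eqP => /aff_inj => /(_ (zH _ _ (sH _ Hb)) (zH _ _ (sH _ Hb))).
    by move/eqP; rewrite -subr_eq0 -scalerBl scaler_eq0 subr_eq0 (negbTE nxy)
      (negbTE (sn0 _ Hb)).
  have ey : aff (s + b) = aff (1 *: (s + b)) by rewrite scale1r.
  have ex : aff (s + a) = aff (lam *: (s + b)) by rewrite e.
  have ez : aff (lam *: (s + a)) = aff ((lam * lam) *: (s + b)).
    by rewrite e scalerA.
  apply: (arcKL (aff (s + b)) (aff (s + a)) (aff (lam *: (s + a)))).
  - exact: KP.
  - exact: KP.
  - exact: LP.
  - by rewrite ey ex scal_neq // eq_sym.
  - by rewrite ey ez scal_neq // eq_sym.
  - by rewrite ex ez scal_neq // -{1}[lam]mulr1 (inj_eq (mulfI lam0)) eq_sym.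
  (* The scalars 0 and 1 give the centre and [aff (s + b)]; the line joining them contains every
     [aff (x *: (s + b))]. *)
  have neq01 : aff (0 *: (s + b)) != aff (1 *: (s + b)).
    by rewrite scal_neq // eq_sym oner_eq0.
  have [l lE] := join_lineP neq01; exists l.
  have cl : c \in val l.
    by rewrite lE; apply: subvP (addvSl _ _) _ _; rewrite /aff scale0r addr0
      val_span_point ?memv_line ?affine_neq0.
  have csl : c + (s + b) \in val l.
    by rewrite lE; apply: subvP (addvSr _ _) _ _; rewrite /aff scale1r
      val_span_point ?memv_line ?affnz ?sH.
  have sl : s + b \in val l by rewrite -(addKr c (s + b)) memvD ?memvN.
  by rewrite ey ex ez !incident_span_point ?affnz ?zH ?sH //; split;
    rewrite memvD // memvZ.
(* [D] holds the secant directions; 0 is left out because [span_point 0] is the default point. [Z]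
   holds the affine blocking points. *)
pose D := [set span_point a | a in H :\ 0].
pose Z := [set aff (mu *: a) | a in H].
(* If distinct [a] and [b] had the same direction, the points of [K] given by 0, [a] and [b] would
   be collinear. *)
have dir_inj : {in H :\ 0 &, injective (@span_point F)}.
  move=> a b /setD1P [nza Ha] /setD1P [nzb Hb] eab.
  apply/eqP/negPn/negP => nab.
  have s_neq x y : x \in H -> y \in H -> x != y -> aff (s + x) != aff (s + y).
    move=> Hx Hy; apply: contraNneq => /aff_inj e.
    by apply/eqP/(addrI s)/e; exact: sH.
  apply: (arcKL (aff (s + 0)) (aff (s + a)) (aff (s + b))); try exact: KP.
  - by rewrite s_neq // eq_sym.
  - by rewrite s_neq // eq_sym.
  - by rewrite s_neq.
  have nz0a : 0 != a by rewrite eq_sym.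
  have [l lE] := join_lineP (s_neq _ _ H0 Ha nz0a).
  have l0 : c + (s + 0) \in val l.
    by rewrite lE; apply: subvP (addvSl _ _) _ _; rewrite
      val_span_point ?memv_line ?affnz ?sH.
  have l1 : c + (s + a) \in val l.
    by rewrite lE; apply: subvP (addvSr _ _) _ _; rewrite
      val_span_point ?memv_line ?affnz ?sH.
  have la : a \in val l.
    have -> : a = c + (s + a) - (c + (s + 0)).
      by rewrite addr0 addrA [_ + a]addrC addrK.
    by rewrite memvB.
  have lb : b \in val l.
    by rewrite -incident_span_point // -eab incident_span_point.
  exists l; rewrite !incident_span_point ?affnz ?sH //; split => //.
  have -> : c + (s + b) = c + (s + 0) + b by rewrite addr0 addrA.
  by rewrite memvD.
have Z_inj : {in H &, injective (fun a => aff (mu *: a))}.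
  move=> a b Ha Hb /aff_inj e.
  by apply: (scalerI mu_neq0); apply: e; apply/zH/H_inf.
have muE (v : 'rV[F]_3) : (1 + lam) *: (mu *: v) = lam *: v.
  by rewrite scalerA mulrC divfK.
have DZ P : P \in D -> P \in Z -> False.
  move=> /imsetP [a /setD1P [nza Ha] ->] /imsetP [b Hb] /(congr1 val).
  rewrite !val_span_point ?affnz ?zH ?H_inf // => e.
  have /vlineP [x ex] : c + mu *: b \in <[a]>%VS by rewrite e memv_line.
  have := aff1 _ (zH mu _ (H_inf _ Hb)); rewrite ex mxE H_inf // mulr0 => /esym/eqP.
  by rewrite oner_eq0.
have KLP P : P \in K :|: L ->
    exists2 a, a \in H & P = aff (s + a) \/ P = aff (lam *: (s + a)).
  by rewrite inE KE LE => /orP [] /imsetP [a Ha ->]; exists a => //; [left | right].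
(* For two points on the same side, [K] or [L], [a + b] is a multiple of their difference, so it is
   the direction of their secant. *)
have blockD (l : line F) a b : a \in H -> b \in H -> a != b -> a + b \in val l ->
    exists2 P, P \in D :|: Z & incident P l.
  move=> Ha Hb nab lab.
  have nz : a + b != 0.
    by apply: contraNneq nab => e; apply/eqP/(addIr b); rewrite e add_self.
  exists (span_point (a + b)); last by rewrite incident_span_point.
  rewrite inE; apply/orP; left; apply/imsetP.
  by exists (a + b); rewrite // !inE nz HD.
have blockZ (l : line F) a b : a \in H -> b \in H -> c + (s + a) \in val l ->
    c + lam *: (s + b) \in val l -> exists2 P, P \in D :|: Z & incident P l.
  move=> Ha Hb la lb; exists (aff (mu *: (a + b))).
    by rewrite inE; apply/orP; right; apply/imsetP; exists (a + b); rewrite // HD.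
  rewrite incident_span_point ?affnz ?zH ?H_inf ?HD //.
  (* With weights [lam] and 1 both copies of [s] get the coefficient [lam] and cancel, while [c]
     gets [1 + lam]. *)
  have -> : c + mu *: (a + b) =
      (1 + lam)^-1 *: (lam *: (c + (s + a)) + (c + lam *: (s + b))).
    apply: (scalerI mu0); rewrite scalerA divff // scale1r scalerDr muE.
    rewrite scalerDl scale1r.
    have -> : a + b = (s + a) + (s + b) by rewrite addrACA add_self add0r.
    by rewrite !(scalerDr lam) [RHS]addrACA [lam *: c + c]addrC -!scalerDr.
  by rewrite memvZ // memvD // memvZ.
exists (D :|: Z); split; first split; first split.
- rewrite -setI_eq0; apply/eqP/setP => P; rewrite [RHS]inE; apply/negbTE/negP.
  case/setIP => /setUP [/imsetP [a /setD1P [nza Ha] ->]|/imsetP [e He ->]].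
    move/KLP => [b Hb PE].
    have [w w0 PEw] : exists2 w : 'rV[F]_3, w 0 2 = 0 & span_point a = aff w.
      by case: PE => ->; [exists (s + b) | exists (lam *: (s + b))]; rewrite ?zH ?sH.
    move/(congr1 val): PEw; rewrite !val_span_point ?affnz // => ee.
    have /vlineP [x ex] : c + w \in <[a]>%VS by rewrite ee memv_line.
    by have /eqP := aff1 _ w0; rewrite ex mxE H_inf // mulr0 eq_sym oner_eq0.
  (* A point of [Z] in [K] yields [s + b = lam *: (s + (b + e))], and one in [L] yields
     [s + (b + e) = lam *: (s + b)]. Either way [K] and [L] would meet. *)
  move/KLP => [b Hb [] /aff_inj ee].
    have {}ee : mu *: e = s + b by apply: ee; rewrite ?zH ?sH ?H_inf.
    apply: (KL_disj b (b + e)) => //; first exact: HD.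
    rewrite addrA scalerDr -(muE e) ee scalerDl scale1r addrCA.
    by rewrite add_self addr0.
  have {}ee : mu *: e = lam *: (s + b) by apply: ee; rewrite ?zH ?sH ?H_inf.
  have {}ee : e = (1 + lam) *: (s + b).
    by apply: (scalerI lam0); rewrite -muE ee !scalerA mulrC.
  apply: (KL_disj (b + e) b) => //; first exact: HD.
  by rewrite addrA ee scalerDl scale1r addrA add_self add0r.
- move=> l [P [Q [/KLP [a Ha PE] /KLP [b Hb QE] nPQ Pl Ql]]].
  case: PE => PE; case: QE => QE; subst P Q;
    move: Pl Ql; rewrite !incident_span_point ?affnz ?zH ?sH // => Pl Ql.
  + apply: (blockD l a b) => //; first by apply: contraNneq nPQ => ->.
    have := memvD Pl Ql.
    by rewrite addrACA add_self add0r addrACA add_self add0r.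
  + exact: (blockZ l a b).
  + exact: (blockZ l b a).
  + apply: (blockD l a b) => //; first by apply: contraNneq nPQ => ->.
    have : lam^-1 *: (c + lam *: (s + a) + (c + lam *: (s + b))) \in val l.
      by rewrite memvZ // memvD.
    rewrite addrACA add_self add0r -scalerDr scalerA mulVf // scale1r.
    by rewrite addrACA add_self add0r.
- have cardZ : #|Z| = #|H| by rewrite card_in_imset.
  have cardD : #|D| = #|H|.-1 by rewrite card_in_imset // (cardsD1 0 H) H0.
  have -> : #|K :|: L| = (#|H| + #|H|)%N.
    rewrite cardsU; have -> : K :&: L = set0.
      apply/setP => P; rewrite [RHS]inE; apply/negbTE/negP; rewrite inE KE LE.
      case/andP => /imsetP [a Ha ->] /imsetP [b Hb] /aff_inj e.
      by apply: (KL_disj a b) => //; apply: e; rewrite ?zH ?sH.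
    rewrite cards0 subn0 KE LE !card_in_imset // => a b Ha Hb /aff_inj e.
      by apply/(addrI s)/(scalerI lam0)/e; rewrite ?zH ?sH.
    by apply/(addrI s)/e; rewrite ?sH.
  rewrite cardsU; have -> : D :&: Z = set0.
    apply/setP => P; rewrite [RHS]inE; apply/negbTE/negP.
    by case/setIP => PD /(DZ _ PD).
  (* The sizes [#|H|.-1] of [D] and [#|H|] of [Z] add up to one less than [#|H| + #|H|]; [cardH]
     rules out a truncated predecessor. *)
  by rewrite cards0 subn0 cardZ cardD; case: #|H| cardH => // n _; rewrite subn1.
case=> l /subsetP DZl.
(* Two nonzero elements of [H] have distinct directions, which force the line to be [linfty]; but 0
   puts the affine centre in [Z]. *)
have /card_gt1P [a [b [Ha Hb nab]]] : (1 < #|H :\ 0%R|)%N.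
  by move: cardH; rewrite (cardsD1 0 H) H0.
have nP : span_point a != span_point b by apply: contra_neq nab; exact: dir_inj.
have on_inf x : x \in H :\ 0 -> incident (span_point x) (linfty F).
  case/setD1P => nzx Hx.
  by rewrite incident_span_point // memv_ker lfunE /= /X3 H_inf.
have on_l x : x \in H :\ 0 -> incident (span_point x) l.
  move=> Hx; have := DZl (span_point x); rewrite !inE; apply.
  by apply/orP; left; apply: imset_f.
have : c \in val l.
  have : aff (mu *: 0) \in points_on l.
    by apply: DZl; rewrite inE; apply/orP; right; apply/imsetP; exists 0.
  by rewrite inE /aff scaler0 addr0 incident_span_point ?affine_neq0.
rewrite (line_eq_join (l := l) nP) ?on_l //.
rewrite -(line_eq_join (l := linfty F) nP) ?on_inf //.
by rewrite memv_ker lfunE /= /X3 c1 oner_eq0.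
Qed.

(* Reduction of the theorem to the affine form *)
Local Close Scope ring_scope.

Theorem theorem4p1 (r : nat) (F : finFieldType) (hq : #|F| = 2 ^ r)
    (k : nat) (hk : 4 <= k) (K : {set point F}) (hK : translation_arc k K)
    (phi : point F -> point F) (C : point F)
    (hphi : homology phi (linfty F) C) (hC : C \notin K)
    (hK' : is_arc (K :|: phi @: K)) :
  exists B : {set point F},
    minimum_blocking_set B (K :|: phi @: K) /\ ~ linear_set B.
Proof.
have ch2 := card_finPcharP hq isT.
have [[cardK _] [G [P [G_zmod P_aff KE]]]] := hK.
have [p p1 PE] := normal_affine P_aff.
have [H [H_zmod H_inf orbE]] := translation_orbitP G_zmod p1.
have [c [lam [c1 CE lam0 lam1 phiE]]] := homologyP hphi.
(* The vector [s] of the affine form is [p - c], the base point of the orbit seen from the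
   centre. *)
have s0 : ((p - c) 0 2 = 0)%R by rewrite !mxE p1 c1 subrr.
have {KE PE orbE}KE : K = [set span_point (c + ((p - c) + a))%R | a in H].
  by rewrite KE PE orbE; apply: eq_imset => a; rewrite addrA [(c + _)%R]addrC subrK.
have LE : phi @: K = [set span_point (c + lam *: ((p - c) + a))%R | a in H].
  rewrite KE -imset_comp; apply: eq_in_imset => a Ha /=; apply: phiE.
  by rewrite mxE s0 add0r H_inf.
apply: (affine_blocking_set ch2 c1 s0 lam0 lam1 H_zmod H_inf KE LE) => //.
  by rewrite -CE.
(* [K] is an image of [H], so [#|H|] is at least [k]. *)
rewrite ltnW // (leq_trans hk) // -cardK KE.
exact: leq_imset_card.
Qed.
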